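(* Let $X$ be a compact Hausdorff space, let $C(X)$ be the $C^*$-algebra of continuous complex-valued functions on $X$, let $\mathcal{H}$ be a Hilbert space, and let $k\ge 1$. If $\varphi: C(X)^k\to \mathcal{B}(\mathcal{H})$ is an invariant positive $k$-linear map, then $\|\varphi\|=\|\varphi(1,1,\ldots,1)\|$.
   Context: Here $\mathcal{A}=C(X)$, $\mathcal{B}=\mathcal{B}(\mathcal{H})$ in the following definitions. Let $\mathcal{A},\mathcal{B}$ be unital $C^*$-algebras, $k\ge1$, $m=\lfloor (k+1)/2\rfloor$ (so $k=2m-1$ or $k=2m$), and $\mathcal{A}^k=\mathcal{A}\times\cdots\times\mathcal{A}$ ($k$ times). A $k$-linear map $\varphi:\mathcal{A}^k\to\mathcal{B}$ is positive if $\varphi(a_1,\ldots,a_k)\ge 0$ whenever $(a_1,a_2,\ldots,a_k)=(a_k^*,a_{k-1}^*,\ldots,a_1^* )$, with the additional assumption $a_m\ge 0$ when $k$ is odd. A $k$-linear map $\varphi:\mathcal{A}^k\to\mathcal{B}$ is invariant if: when $k=2m-1$, $\varphi(a_1c_1,\ldots,a_{m-1}c_{m-1},a_m,a_{m+1},\ldots,a_{2m-1})=\varphi(a_1,\ldots,a_{m-1},a_m,c_{m-1}a_{m+1},\ldots,c_1a_{2m-1})$ for all $a_1,\ldots,a_{2m-1},c_1,\ldots,c_{m-1}\in\mathcal{A}$; when $k=2m$, $\varphi(a_1c_1,\ldots,a_mc_m,a_{m+1},\ldots,a_{2m})=\varphi(a_1,\ldots,a_m,c_ma_{m+1},\ldots,c_1a_{2m})$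 for all $a_1,\ldots,a_{2m},c_1,\ldots,c_m\in\mathcal{A}$. The norm is $\|\varphi\|=\sup\{\|\varphi(a_1,\ldots,a_k)\|:\|a_l\|\le 1 \text{ for } 1\le l\le k\}$. *)

(* Defs.v *)
From HB Require Import structures.
From mathcomp Require Import all_boot all_order all_algebra.
From mathcomp Require Import sesquilinear.
From mathcomp Require Import complex.
From mathcomp Require Import all_classical all_reals all_analysis.

Set Implicit Arguments.
Unset Strict Implicit.
Unset Printing Implicit Defensive.

Import Order.TTheory GRing.Theory Num.Theory.
Import numFieldNormedType.Exports.

Local Open Scope classical_set_scope.
Local Open Scope ring_scope.

(* The library equips K^o (rather than K) with the metric topology when K is a
   concrete numFieldType such as R[i]. *)
Notation cfun X K := (continuousType X K^o).

Section ContinuousFunctions.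
Variables (X : topologicalType) (K : numFieldType).

Definition cfun_pred : {pred X -> K^o} := mem [set f | continuous f].
Definition cfun_key : pred_key cfun_pred. Proof. exact. Qed.
Canonical cfun_keyed := KeyedPred cfun_key.

Section Sub.
Variables (f : X -> K^o) (fP : f \in cfun_pred).
Definition cfun_Sub_subproof := @isContinuous.Build X K^o f (set_mem fP).
#[local] HB.instance Definition _ := cfun_Sub_subproof.
Definition cfun_Sub : cfun X K := f.
End Sub.

Lemma cfun_rect (P : (cfun X K) -> Type) :
  (forall f (Pf : f \in cfun_pred), P (cfun_Sub Pf)) -> forall u, P u.
Proof.
move=> Psub [f [[Pf]]]/=.
by suff -> : Pf = set_mem (@mem_set _ [set f | _] f Pf) by apply: Psub.
Qed.

Lemma cfun_valP f (Pf : f \in cfun_pred) : cfun_Sub Pf = f :> (_ -> _).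
Proof. by []. Qed.

HB.instance Definition _ := isSub.Build _ _ (cfun X K) cfun_rect cfun_valP.

Lemma cfun_subring_closed : subring_closed cfun_pred.
Proof.
split=> [|f g /set_mem/= cf /set_mem/= cg|f g /set_mem/= cf /set_mem/= cg];
  apply: mem_set => /= x.
- exact: cvg_cst.
- by apply: (@cvgB _ K^o); [exact: cf|exact: cg].
- by apply: (@cvgM K); [exact: cf|exact: cg].
Qed.

Lemma cfun_submod_closed : submod_closed cfun_pred.
Proof.
split=> [|a f g /set_mem/= cf /set_mem/= cg]; apply: mem_set => /= x.
  exact: cvg_cst.
by apply: (@cvgD _ K^o); [apply: (@cvgZr K K^o); exact: cf|exact: cg].
Qed.

HB.instance Definition _ :=
  GRing.isSubringClosed.Build _ cfun_pred cfun_subring_closed.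
HB.instance Definition _ :=
  GRing.isSubmodClosed.Build _ _ cfun_pred cfun_submod_closed.
HB.instance Definition _ := GRing.SubChoice_isSubComPzRing.Build _ _ (cfun X K)
  (subringClosedP _).
HB.instance Definition _ := [SubZmodule_isSubLmodule of (cfun X K) by <:].
End ContinuousFunctions.

Section Involution.
Variables (X : topologicalType) (K : numClosedFieldType) (f : cfun X K).

Lemma cfun_conj_continuous : continuous ((fun x => (f x)^*) : X -> K^o).
Proof.
move=> x; apply/(@cvgrPdist_lt K K^o) => e e0.
have /(@cvgrPdist_lt K K^o)/(_ _ e0) := @cts_fun _ _ f x.
by apply: filterS => y; rewrite -rmorphB norm_conjC.
Qed.

Definition cfun_star : cfun X K := mkcts cfun_conj_continuous.
End Involution.

Section BoundedOperators.
Variables (K : numFieldType) (V : normedModType K).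

Definition bop_pred : {pred V -> V} :=
  mem [set T | linear T /\ exists M, forall x, `|T x| <= M * `|x|].

Record bop := Bop { bop_fun :> V -> V; _ : bop_fun \in bop_pred }.

HB.instance Definition _ := [isSub for bop_fun].
HB.instance Definition _ := [Choice of bop by <:].

Lemma bop_submod_closed : submod_closed bop_pred.
Proof.
split=> [|a S T /set_mem/= [lS [M bS]] /set_mem/= [lT [N bT]]]; apply: mem_set.
  split=> [b x y|]; first by rewrite scaler0 addr0.
  by exists 0 => x; rewrite normr0 mul0r.
split=> [b x y|].
  change (a *: S (b *: x + y) + T (b *: x + y) =
    b *: (a *: S x + T x) + (a *: S y + T y)).
  rewrite lS lT !scalerDr !scalerA [b * a]mulrC -!addrA; congr (_ + _).
  by rewrite addrCA.
exists (`|a| * M + N) => x; rewrite mulrDl.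
apply: (le_trans (ler_normD _ _)); apply: lerD (bT x).
by rewrite normrZ -mulrA ler_wpM2l.
Qed.

HB.instance Definition _ :=
  GRing.isSubmodClosed.Build _ _ bop_pred bop_submod_closed.
HB.instance Definition _ := [SubChoice_isSubLmodule of bop by <:].
End BoundedOperators.

(* {dot H for conj} is linear in its first argument. *)
HB.mixin Record NormedModule_isHilbert (R : realType) H
    of CompleteNormedModule R[i] H := {
  inner : {dot H for (@Num.conj R[i])};
  innerE : forall u : H, inner u u = `|u| ^+ 2
}.

#[short(type="hilbertType")]
HB.structure Definition Hilbert (R : realType) :=
  { H of NormedModule_isHilbert R H & CompleteNormedModule R[i] H }.

(* The norm of a normedModType R[i] is valued in R[i]; rnorm is the same
   nonnegative real number as an element of R. *)
Definition rnorm (R : realType) (V : normedModType R[i]) (v : V) : R :=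
  complex.Re `|v|.

(* sup set0 = 0, which is the right value when X is empty. *)
Definition sup_norm (X : topologicalType) (R : realType) (f : cfun X R[i]) : R :=
  sup [set rnorm (f x) | x in [set: X]].

Definition op_norm (R : realType) (V : normedModType R[i]) (T : bop V) : R :=
  sup [set rnorm (T x) | x in [set x | rnorm x <= 1]].

(* On R[i], 0 <= z means that z is real and nonnegative. *)
Definition cfun_nonneg (X : topologicalType) (R : realType) (f : cfun X R[i]) :=
  forall x, 0 <= (f x : R[i]).

Definition bop_nonneg (R : realType) (H : hilbertType R) (T : bop H) :=
  forall x : H, 0 <= inner (T x) x.

(* In the definitions below the argument a_l of a k-linear map, 1 <= l <= k, is
   a i with i = l - 1 : 'I_k, and the reversal l |-> k + 1 - l is rev_ord. *)

Definition is_multilinear (F : pzRingType) (A B : lmodType F) (k : nat)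
    (phi : ('I_k -> A) -> B) :=
  forall (a : 'I_k -> A) (i : 'I_k),
    linear (fun x : A => phi (@dfwith 'I_k (fun=> A) a i x)).

(* The number of c_l is m - 1 if k = 2m - 1 and m if k = 2m: it is k./2 in both
   cases. Only the first k./2 values of c are used. *)
Definition is_invariant (A : pzRingType) (B : Type) (k : nat)
    (phi : ('I_k -> A) -> B) :=
  forall a c : 'I_k -> A,
    phi (fun i => if (i < k./2)%N then a i * c i else a i) =
    phi (fun i => if (rev_ord i < k./2)%N then c (rev_ord i) * a i else a i).

Section MapsIntoOperators.
Variables (X : topologicalType) (R : realType) (H : hilbertType R) (k : nat).
Variable phi : ('I_k -> cfun X R[i]) -> bop H.

(* For odd k, a_m with m = (k + 1) / 2 is the middle argument. *)
Definition is_positive :=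
  forall a : 'I_k -> cfun X R[i],
    (forall i, a i = cfun_star (a (rev_ord i))) ->
    (odd k -> forall i : 'I_k, i.+1 = k.+1./2 -> cfun_nonneg (a i)) ->
    bop_nonneg (phi a).

(* Extended-real valued, as phi is not assumed bounded. *)
Definition multilinear_norm : \bar R :=
  ereal_sup [set (op_norm (phi a))%:E
            | a in [set a | forall i, sup_norm (a i) <= 1]].

End MapsIntoOperators.

(* Main.v *)
Require Import Defs.
From HB Require Import structures.
From mathcomp Require Import all_boot all_order all_algebra.
From mathcomp Require Import sesquilinear.
From mathcomp Require Import complex.
From mathcomp Require Import all_classical all_reals all_analysis.
From mathcomp Require Import ring zify.

Set Implicit Arguments.
Unset Strict Implicit.
Unset Printing Implicit Defensive.

Import Order.TTheory GRing.Theory Num.Theory.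
Import numFieldNormedType.Exports.

Local Open Scope classical_set_scope.
Local Open Scope ring_scope.

(* Any f in C(X) with |f| <= 1 is, for every e > 0, an exact finite combination
   of a partition of unity with coefficients of modulus at most 1 + e: compose f
   with piecewise bilinear interpolation on a fine square grid. Invariance and
   square roots show that phi is positive on all tuples of nonnegative functions.
   Expanding one argument after the other, phi(a) becomes a sum of c_J P_J with
   P_J >= 0, sum_J P_J = phi(1, ..., 1) and |c_J| bounded by a power of 1 + e.
   By Cauchy-Schwarz for each P_J, in the additive form
   2 |<P x, y>| <= <P x, x> + <P y, y>, the norm is at most that of
   phi(1, ..., 1). The expansion being exact, no continuity of phi is needed. *)

(** * Tent functions on the integer nodes *)

Section Tent.
Variable K : numClosedFieldType.
Implicit Types (t : K) (j n : nat).

(* The piecewise linear function with value 1 at [j] and 0 outside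
   [j - 1, j + 1], for real [t]. *)
Definition tent j t : K :=
  2^-1 * (`|t - j%:R + 1| - 2 * `|t - j%:R| + `|t - j%:R - 1|).

Lemma tent_ge0 j t : 0 <= tent j t.
Proof.
rewrite mulr_ge0 ?invr_ge0// addrAC subr_ge0.
have -> : 2 * `|t - j%:R| = `|(t - j%:R + 1) + (t - j%:R - 1)|.
  by rewrite -[2 in LHS](normr_nat K) -normrM; congr `|_|; ring.
exact: ler_normD.
Qed.

(** Each tent is half a second difference of the absolute value, so the sum telescopes to boundary
    terms. *)
Lemma sum_tent n t : \sum_(j < n) tent j t =
  2^-1 * (`|t + 1| - `|t| - `|t - n%:R + 1| + `|t - n%:R|).
Proof.
elim: n => [|n IHn]; first by rewrite big_ord0 subr0; ring.
rewrite big_ord_recr/= {}IHn /tent (_ : t - n.+1%:R + 1 = t - n%:R); last first.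
  by rewrite -natr1; ring.
rewrite (_ : t - n.+1%:R = t - n%:R - 1); last by rewrite -natr1; ring.
by ring.
Qed.

(** Summation by parts applied to the same second differences. *)
Lemma sum_tent_node n t : \sum_(j < n) j%:R * tent j t =
  2^-1 * (`|t| + (n%:R - 1) * `|t - n%:R| - n%:R * `|t - n%:R + 1|).
Proof.
elim: n => [|n IHn]; first by rewrite big_ord0 subr0; ring.
rewrite big_ord_recr/= {}IHn /tent (_ : t - n.+1%:R + 1 = t - n%:R); last first.
  by rewrite -natr1; ring.
rewrite (_ : t - n.+1%:R = t - n%:R - 1); last by rewrite -natr1; ring.
by rewrite -natr1; ring.
Qed.

Lemma sum_tent_eq1 n t : 0 <= t <= n%:R -> \sum_(j < n.+1) tent j t = 1.
Proof.
move=> /andP[t0 tn]; have nt0 : 0 <= n%:R - t by rewrite subr_ge0.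
rewrite sum_tent (ger0_norm t0).
rewrite (ger0_norm (addr_ge0 t0 ler01)).
have -> : t - n.+1%:R + 1 = - (n%:R - t) by rewrite -natr1; ring.
have -> : t - n.+1%:R = - (n%:R - t + 1) by rewrite -natr1; ring.
rewrite !normrN (ger0_norm nt0) (ger0_norm (addr_ge0 nt0 ler01)).
by field.
Qed.

Lemma sum_tent_node_eq n t :
  0 <= t <= n%:R -> \sum_(j < n.+1) j%:R * tent j t = t.
Proof.
move=> /andP[t0 tn]; have nt0 : 0 <= n%:R - t by rewrite subr_ge0.
rewrite sum_tent_node (ger0_norm t0).
have -> : t - n.+1%:R + 1 = - (n%:R - t) by rewrite -natr1; ring.
have -> : t - n.+1%:R = - (n%:R - t + 1) by rewrite -natr1; ring.
rewrite !normrN (ger0_norm nt0) (ger0_norm (addr_ge0 nt0 ler01)) -natr1.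
by field.
Qed.

(** If [|s| > 1] with [s] real, then [s - 1], [s] and [s + 1] lie on one side of 0, where the
    absolute value is affine and its second difference vanishes. *)
Lemma tent_neq0 j t : t \is Num.real -> tent j t != 0 -> `|t - j%:R| <= 1.
Proof.
move=> tr; rewrite /tent; set s := t - j%:R.
have sr : s \is Num.real by rewrite realB ?realn.
apply: contraNT; rewrite -real_ltNge ?real1 ?normr_real// => s1.
rewrite mulf_eq0; apply/orP; right; apply/eqP.
case: (real_ge0P sr) s1 => [s0|s0] s1.
  have s10 : 0 <= s - 1 by rewrite subr_ge0 ltW.
  by rewrite (ger0_norm (addr_ge0 s0 ler01)) (ger0_norm s10); ring.
have s10 : s + 1 <= 0 by rewrite -lerBrDr sub0r lerNr ltW.
have s1' : s - 1 <= 0 by rewrite subr_le0 (le_trans (ltW s0)).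
by rewrite (ler0_norm s10) (ler0_norm s1'); ring.
Qed.

End Tent.

(** * Grid partitions of unity in [C(X)] *)

Section CfunPartition.
Variables (X : topologicalType) (K : numClosedFieldType).
Implicit Types f : cfun X K.

Lemma cfun_norm_continuous f : continuous ((fun x => `|f x|) : X -> K^o).
Proof.
move=> x; apply/(@cvgrPdist_lt K K^o) => e e0.
have /(@cvgrPdist_lt K K^o)/(_ _ e0) := @cts_fun _ _ f x.
by apply: filterS => y; apply: le_lt_trans; exact: ler_dist_dist.
Qed.

Definition cfun_norm f : cfun X K := mkcts (@cfun_norm_continuous f).

(** Built from the module operations and [cfun_norm], so that continuity comes with the type. *)
Definition cfun_tent j f : cfun X K :=
  let g : cfun X K := f - j%:R *: (1 : cfun X K) in
  2^-1 *: (cfun_norm (g + 1) - 2 *: cfun_norm g + cfun_norm (g - 1)).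

Lemma cfun_tentE j f x : cfun_tent j f x = tent j (f x : K).
Proof.
by rewrite /tent -[j%:R in RHS]mulr1.
Qed.

Lemma cfun_sum_apply (I : Type) (r : seq I) (P : pred I) (F : I -> cfun X K) x :
  (\sum_(i <- r | P i) F i) x = \sum_(i <- r | P i) F i x.
Proof. by elim/big_rec2 : _ => // i y1 y2 _ <-. Qed.

Definition cfun_Re f : cfun X K := 2^-1 *: (f + cfun_star f).
Definition cfun_Im f : cfun X K := 2^-1 *: ('i *: (cfun_star f - f)).

Lemma cfun_ReE f x : cfun_Re f x = 'Re (f x : K).
Proof. by rewrite ReE mulrC. Qed.

Lemma cfun_ImE f x : cfun_Im f x = 'Im (f x : K).
Proof. by rewrite ImE mulrC. Qed.

(* The grid point [(j + 'i * l) / n - (1 + 'i)], for [0 <= j, l <= 2 * n], carries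
   the weight [tent j (n * ('Re f + 1)) * tent l (n * ('Im f + 1))]. Linear
   interpolation reproduces affine functions exactly, and a weight vanishes
   identically unless its node is within [2 / n] of the unit disc. *)
Lemma cfun_partition f n : (0 < n)%N -> (forall x, `|f x : K| <= 1) ->
  exists (J : finType) (lam : J -> K) (u : J -> cfun X K),
  [/\ forall j x, 0 <= (u j x : K), \sum_j u j = 1, \sum_j lam j *: u j = f &
      forall j, u j = 0 \/ `|lam j| <= 1 + 2 / n%:R].
Proof.
move=> n0 f1; have nn0 : n%:R != 0 :> K by rewrite pnatr_eq0 -lt0n.
have n0' : 0 <= n%:R^-1 :> K by rewrite invr_ge0.
pose N := n.*2; have NE : N%:R = 2 * n%:R :> K by rewrite /N -mul2n natrM.
pose node (j : 'I_N.+1) : K := (j%:R - n%:R) / n%:R.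
pose T (j : 'I_N.+1) := cfun_tent j (n%:R *: (cfun_Re f + 1)).
pose S (j : 'I_N.+1) := cfun_tent j (n%:R *: (cfun_Im f + 1)).
pose t x : K := n%:R * ('Re (f x : K) + 1).
pose s x : K := n%:R * ('Im (f x : K) + 1).
have TE j x : T j x = tent j (t x) by rewrite cfun_tentE /t -cfun_ReE.
have SE j x : S j x = tent j (s x) by rewrite cfun_tentE /s -cfun_ImE.
have rescale (y : K) : y \is Num.real -> `|y| <= 1 ->
    0 <= n%:R * (y + 1) <= N%:R.
  move=> yr; rewrite real_ler_norml// => /andP[y1 y2].
  by rewrite NE mulr_ge0 ?ler0n -?lerBlDr ?sub0r//= mulrC ler_wpM2r// -lerBrDr
    (le_trans y2)// -(natrB _ (_ : (1 <= 2)%N)).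
have tN x : 0 <= t x <= N%:R.
  by rewrite rescale ?Creal_Re// (le_trans (leif_normC_Re_Creal _)).
have sN x : 0 <= s x <= N%:R.
  rewrite rescale ?Creal_Im// -normrN -ReMil.
  by rewrite (le_trans (leif_normC_Re_Creal _))// normrM normCi mul1r.
have sum_node (r : K) : 0 <= r <= N%:R ->
    \sum_(j < N.+1) node j * tent j r = r / n%:R - 1.
  move=> rN; transitivity
      ((\sum_(j < N.+1) j%:R * tent j r) / n%:R - \sum_(j < N.+1) tent j r).
    by rewrite mulr_suml -sumrB; apply: eq_bigr => j _; rewrite /node; field.
  by rewrite sum_tent_node_eq// sum_tent_eq1.
exists ('I_N.+1 * 'I_N.+1)%type, (fun p => node p.1 + 'i * node p.2),
  (fun p => T p.1 * S p.2); split.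
- move=> [j l] x; change (0 <= (T j x : K) * S l x).
  by rewrite TE SE mulr_ge0 ?tent_ge0.
- apply/continuousEP => x; rewrite cfun_sum_apply.
  transitivity (\sum_(j < N.+1) \sum_(l < N.+1) tent j (t x) * tent l (s x)).
    rewrite pair_bigA; apply: eq_bigr => -[j l] _.
    by transitivity (T j x * S l x : K); [|rewrite TE SE].
  by rewrite -big_distrlr/= !sum_tent_eq1// mulr1.
- apply/continuousEP => x; rewrite cfun_sum_apply.
  transitivity
    ((\sum_(j < N.+1) node j * tent j (t x)) * (\sum_(l < N.+1) tent l (s x)) +
     'i * ((\sum_(j < N.+1) tent j (t x)) *
           (\sum_(l < N.+1) node l * tent l (s x)))).
    rewrite !big_distrlr/= !pair_bigA mulr_sumr -big_split.
    apply: eq_bigr => -[j l] _.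
    transitivity ((node j + 'i * node l) * (T j x * S l x)); first by [].
    rewrite TE SE /=; move: (tent j _) (tent l _) (node j) (node l) => *.
    by ring.
  rewrite !sum_tent_eq1// !sum_node//.
  rewrite mulr1 mul1r {1}/t {1}/s [RHS](Crect (f x : K)).
  by field.
- move=> [j l]; have [u0|] := pselect (forall x, T j x * S l x = 0 :> K).
    by left; apply/continuousEP => x; exact: u0.
  move=> /existsNP[x /eqP]; rewrite mulf_eq0 negb_or TE SE => /andP[Tx Sx].
  right => /=.
  (* At a point [x] where both tents are nonzero, each coordinate of the grid point is within
     [1 / n] of that of [f x]; the two errors add up to [2 / n]. *)
  have node_near (y r : K) (m : 'I_N.+1) : r = n%:R * (y + 1) ->
      0 <= r <= N%:R -> tent m r != 0 -> `|node m - y| <= n%:R^-1.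
    move=> rE /andP[r0 _] /(tent_neq0 (ger0_real r0)) rm.
    rewrite (_ : node m - y = - (r - m%:R) / n%:R); last first.
      by rewrite rE /node; field.
    by rewrite normrM normrN normfV normr_nat ler_piMl.
  have -> : node j + 'i * node l =
      f x + ((node j - 'Re (f x : K)) + 'i * (node l - 'Im (f x : K))).
    by rewrite {1}[f x : K]Crect; ring.
  rewrite (le_trans (ler_normD _ _))// lerD//.
  rewrite (le_trans (ler_normD _ _))// normrM normCi mul1r.
  rewrite mulrDl mul1r lerD//; first exact: (node_near _ (t x)).
  exact: (node_near _ (s x)).
Qed.

End CfunPartition.

(** * Square roots in [C(X)] *)

Section CfunSqrt.
Variables (X : topologicalType) (K : numClosedFieldType).

(** For [u, v >= 0] one has [|u - v| ^ 2 <= |u ^ 2 - v ^ 2|], so a tolerance [e ^ 2] for [|f|]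
    suffices. The modulus makes the root total on [C(X)]. *)
Lemma cfun_sqrt_continuous (f : cfun X K) :
  continuous ((fun x => sqrtC `|f x|) : X -> K^o).
Proof.
move=> x; apply/(@cvgrPdist_lt K K^o) => e e0.
have /(@cvgrPdist_lt K K^o)/(_ _ (exprn_gt0 2 e0)) :=
  @cfun_norm_continuous _ _ f x.
apply: filterS => y fy; rewrite -(ltr_pXn2r (_ : 0 < 2)%N) ?nnegrE ?(ltW e0)//.
apply: le_lt_trans fy; set u := sqrtC `|f x|; set v := sqrtC `|f y|.
have [u0 v0] : 0 <= u /\ 0 <= v by rewrite !sqrtC_ge0.
rewrite -[`|f x|]sqrtCK -[`|f y|]sqrtCK -/u -/v subr_sqr normrM expr2.
by rewrite ler_wpM2l// (le_trans (ler_normB _ _))// !ger0_norm ?addr_ge0.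
Qed.

Definition cfun_sqrt f : cfun X K := mkcts (@cfun_sqrt_continuous f).

End CfunSqrt.

(** * Invariance, and positivity on nonnegative tuples *)

Section MapsOnNonnegativeTuples.
Variables (X : topologicalType) (R : realType) (H : hilbertType R) (k : nat).
Variable phi : ('I_k -> cfun X R[i]) -> bop H.
Hypotheses (phi_invariant : is_invariant phi) (phi_positive : is_positive phi).

(** Invariance carries the whole first half of a tuple to the mirrored places and leaves 1 behind.
    Hence [phi] sees only the products of mirror pairs and, for odd [k], the middle entry. *)
Lemma invariant_eq_mirror (a b : 'I_k -> cfun X R[i]) :
  (forall i, a (rev_ord i) * a i = b (rev_ord i) * b i) ->
  (forall i, rev_ord i = i -> a i = b i) -> phi a = phi b.
Proof.
have fold c : phi c = phi (fun i : 'I_k => if (rev_ord i < k./2)%N then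
    c (rev_ord i) * c i else if (i < k./2)%N then 1 else c i).
  pose d (i : 'I_k) : cfun X R[i] := if (i < k./2)%N then 1 else c i.
  transitivity (phi (fun i : 'I_k => if (i < k./2)%N then d i * c i else d i)).
    congr phi; apply/funext => i; rewrite /d.
    by case: (ltnP i k./2) => // _; rewrite mul1r.
  transitivity (phi (fun i : 'I_k => if (rev_ord i < k./2)%N then
    c (rev_ord i) * d i else d i)); first exact: phi_invariant.
  congr phi; apply/funext => i; rewrite /d.
  case: ifPn => // ri; case: ifPn => // ri'; exfalso.
  by move: ri ri' (ltn_ord i) => /=; lia.
move=> eq_prod eq_mid; rewrite fold [RHS]fold; congr phi; apply/funext => i.
case: ifPn => [_|ri]; first exact: eq_prod.
case: ifPn => // li; apply: eq_mid.
by apply: val_inj; move: ri li (ltn_ord i) => /=; lia.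
Qed.

(** The geometric means [s i] of mirror pairs form a symmetric nonnegative tuple with the same
    mirror products and middle entry as [b], and positivity applies to it. *)
Lemma positive_nonneg_tuple (b : 'I_k -> cfun X R[i]) :
  (forall i, cfun_nonneg (b i)) -> bop_nonneg (phi b).
Proof.
move=> b0; pose s (i : 'I_k) := cfun_sqrt (b i * b (rev_ord i)).
have sE i x : s i x = sqrtC (b i x * b (rev_ord i) x).
  by congr sqrtC; rewrite ger0_norm// mulr_ge0//; exact: b0.
have s0 i x : 0 <= (s i x : R[i]) by rewrite sE sqrtC_ge0 mulr_ge0//; exact: b0.
have sC i : s (rev_ord i) = s i by rewrite /s rev_ordK mulrC.
have <- : phi s = phi b.
  apply: invariant_eq_mirror => i.
    apply/continuousEP => x; rewrite sC.
    transitivity ((s i x : R[i]) ^+ 2); first by rewrite expr2.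
    by rewrite sE sqrtCK mulrC.
  move=> ri; apply/continuousEP => x.
  by rewrite sE ri -expr2 sqrCK//; exact: b0.
apply: phi_positive => [i|_ i _]; last exact: s0.
apply/continuousEP => x; rewrite sC.
apply/esym; change ((s i x : R[i])^* = s i x).
by rewrite conj_Creal// ger0_real.
Qed.

End MapsOnNonnegativeTuples.

(* The hypothesis is the nonnegativity of a sesquilinear form at [c *: y + x]; for
   [c = 1] and [c = 'i] it gives [t = s^*], and then one takes [c = - s / `|s|]. *)
Lemma cross_term_le (C : numClosedFieldType) (A B s t : C) : 0 <= B ->
  (forall c : C, 0 <= c * (c^* * B) + c * t + (c^* * s + A)) ->
  2 * `|s| <= A + B.
Proof.
move=> B0 posE.
have pos (c : C) : 0 <= `|c| ^+ 2 * B + A + (c * t + c^* * s).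
  by have := posE c; rewrite normCK [c^* * s + A]addrC addrACA mulrA.
have A0 : 0 <= A.
  by have := pos 0; rewrite normr0 conjC0 expr0n !mul0r !addr0 add0r.
have cross_real (c : C) : (c * t + c^* * s)^* = c * t + c^* * s.
  apply/CrealP; rewrite -[X in X \is _](addKr (`|c| ^+ 2 * B + A)).
  rewrite realD ?realN ?(ger0_real (pos c))// ger0_real// addr_ge0//.
  by rewrite mulr_ge0// exprn_ge0.
have tE : t = s^*.
  have := cross_real 1; have := cross_real 'i.
  rewrite conjC1 !mul1r !rmorphD !rmorphM/= !conjCK !conjCi => h1 h2.
  have i2 : 'i * 2 != 0 :> C by rewrite mulf_neq0 ?neq0Ci ?pnatr_eq0.
  apply/eqP; rewrite -subr_eq0 -(mulIr_eq0 _ (mulIf i2)).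
  have -> : (t - s^*) * ('i * 2) =
      ('i * t + - 'i * s - (- 'i * t^* + 'i * s^*)) +
      'i * (t + s - (t^* + s^*)) by ring.
  by rewrite h1 h2 !subrr mulr0 addr0.
have [->|s0] := eqVneq s 0; first by rewrite normr0 mulr0 addr_ge0.
have ns0 : `|s| != 0 by rewrite normr_eq0.
pose c := - (s / `|s|).
have c1 : `|c| = 1 by rewrite normrN normrM normfV normr_id divff.
have cs : c^* * s = - `|s|.
  rewrite /c rmorphN rmorphM /= fmorphV /= (conj_Creal (normr_real s)).
  by rewrite mulNr mulrAC [_ * s]mulrC -normCK expr2 mulfK.
have := pos c; rewrite c1 tE.
have -> : c * s^* = (c^* * s)^* by rewrite rmorphM /= conjCK.
rewrite cs rmorphN /= conj_Creal ?normr_real//.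
rewrite expr1n mul1r -opprD subr_ge0 addrC.
by rewrite -mulr2n mulr_natl [A + B]addrC.
Qed.

Lemma rnorm_le (R : realType) (V : normedModType R[i]) (x : V) (r : R) :
  (rnorm x <= r) = (`|x| <= r%:C%C).
Proof. by rewrite -lecR /rnorm RRe_real// normr_real. Qed.

(** * Operators dominated by nonnegative ones *)

Section Domination.
Variables (R : realType) (H : hilbertType R).
Implicit Types (T P : bop H) (x y : H).

(* If [T = \sum_j c j *: P j] with [`|c j| <= 1] and [P j >= 0], then [T] is
   dominated by [\sum_j P j]. *)
Definition dominated T P :=
  forall x y, 2 * `|inner (T x) y| <= inner (P x) x + inner (P y) y.

Lemma bop_linear T : linear T.
Proof. by have /set_mem[] := valP T. Qed.

Lemma inner_expand (c : R[i]) (u v x y : H) :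
  inner (c *: u + x) (c *: v + y) =
    c * (c^* * inner u v) + c * inner u y + (c^* * inner x v + inner x y).
Proof.
have innerDl a b z : inner (a + b) z = inner a z + inner b z by exact: linearDl.
have innerDr z a b : inner z (a + b) = inner z a + inner z b by exact: linearDr.
have innerZl a z : inner (c *: a) z = c * inner a z by exact: linearZl.
have innerZr z a : inner z (c *: a) = c^* * inner z a by exact: linearZr.
by rewrite innerDl !innerDr !innerZl !innerZr.
Qed.

Lemma nonneg_dominated P : bop_nonneg P -> dominated P P.
Proof.
move=> P0 x y; apply: (@cross_term_le R[i] _ _ _ (inner (P y) x)) => // c.
have := P0 (c *: y + x).
by rewrite bop_linear inner_expand.
Qed.

Lemma inner_norm_le x y : `|y| <= 1 -> `|inner x y| <= `|x|.
Proof.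
move=> y1; have [->|x0] := eqVneq x 0; first by rewrite linear0l !normr0.
have nx0 : `|x| != 0 by rewrite normr_eq0.
have nx_gt0 : 0 < `|x| by rewrite normr_gt0.
(* For a unit vector [u] the additive inequality gives [2 * |<u, y>| <= 1 + 1]; rescaling yields the
   claim. *)
pose u := `|x|^-1 *: x.
have u1 : `|u| = 1 by rewrite normrZ normfV normr_id mulVf.
have : 2 * `|inner u y| <= `|u| ^+ 2 + `|y| ^+ 2.
  apply: (@cross_term_le R[i] _ _ _ (inner y u)); first exact: exprn_ge0.
  move=> c; rewrite -!innerE.
  have := exprn_ge0 2 (normr_ge0 (c *: y + u)); rewrite -innerE.
  by rewrite inner_expand.
rewrite u1 expr1n linearZl_LR normrM normfV normr_id => h.
have := le_trans h (lerD (lexx 1) (exprn_ile1 2 (normr_ge0 y) y1)).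
by rewrite -[1 + 1]mulr1 ler_pM2l// mulrC ler_pdivrMr// mul1r.
Qed.

Lemma rnorm_le_op_norm P x : rnorm x <= 1 -> rnorm (P x) <= op_norm P.
Proof.
move=> x1; apply: ub_le_sup; last by exists x.
have /set_mem[_ [M PM]] := valP P.
(* [M] is only known to lie in [R[i]]; its modulus is a real bound. *)
exists (complex.Re `|M|) => _ [y y1 <-].
rewrite rnorm_le RRe_real ?normr_real//.
have My0 : 0 <= M * `|y| := le_trans (normr_ge0 _) (PM y).
rewrite (le_trans (PM y))// -(ger0_norm My0) normrM normr_id.
by rewrite ler_piMr//; move: y1; rewrite /= rnorm_le.
Qed.

(** Test domination against [y = T x / |T x|]: the left side becomes [2 * |T x|], and each term on
    the right is at most [op_norm P]. *)
Lemma dominated_norm T P x :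
  dominated T P -> rnorm x <= 1 -> rnorm (T x) <= op_norm P.
Proof.
move=> TP x1.
have form_le y : rnorm y <= 1 -> inner (P y) y <= (op_norm P)%:C%C.
  move=> y1; have := rnorm_le_op_norm P y1; rewrite rnorm_le.
  apply: le_trans; rewrite rnorm_le in y1; have := inner_norm_le (P y) y1.
  apply: le_trans.
  (* Domination at [(y, y)] already forces [<P y, y> >= 0]. *)
  have := TP y y; have -> : inner (P y) y + inner (P y) y = 2 * inner (P y) y.
    by rewrite mulr_natl mulr2n.
  rewrite ler_pM2l// => yy.
  by rewrite (ger0_norm (le_trans (normr_ge0 _) yy)).
rewrite rnorm_le; have [->|Tx0] := eqVneq (T x) 0.
  rewrite normr0 ler0c.
  have x0 : rnorm (0 : H) <= 1 by rewrite rnorm_le normr0 ler01.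
  apply: le_trans (rnorm_le_op_norm P x0).
  by rewrite -ler0c RRe_real ?normr_real.
have nTx0 : `|T x| != 0 by rewrite normr_eq0.
pose y := `|T x|^-1 *: T x.
have y1 : rnorm y <= 1 by rewrite rnorm_le normrZ normfV normr_id mulVf.
have := TP x y.
have -> : inner (T x) y = `|T x|.
  rewrite linearZr /= innerE conj_Creal ?realV ?normr_real//.
  by rewrite expr2 mulKf.
rewrite normr_id => h.
have := le_trans h (lerD (form_le _ x1) (form_le _ y1)).
have -> (z : R[i]) : z + z = 2 * z by rewrite mulr_natl mulr2n.
by rewrite ler_pM2l.
Qed.

End Domination.

(** * The supremum norm on compact spaces *)

Section SupNorm.
Variables (R : realType) (X : topologicalType).
Hypothesis X_compact : compact [set: X].
Implicit Type f : cfun X R[i].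

Lemma rnorm_cfun_continuous f : continuous (fun x => rnorm (f x)).
Proof.
move=> x; apply/cvgrPdist_lt => e e0.
have e0' : 0 < e%:C%C by rewrite ltcR.
have /(@cvgrPdist_lt R[i] R[i]^o)/(_ _ e0') := @cts_fun _ _ f x.
apply: filterS => y fxy; rewrite -ltcR; apply: le_lt_trans fxy.
apply: le_trans (ler_dist_dist _ _); rewrite /rnorm.
have -> : complex.Re `|f x| - complex.Re `|f y| = complex.Re (`|f x| - `|f y|).
  by [].
exact: normc_ge_Re.
Qed.

Lemma le_sup_norm f x : rnorm (f x) <= sup_norm f.
Proof.
apply: ub_le_sup; last by exists x.
(* The values are bounded by the maximum that compactness provides, so [sup] is a genuine upper
   bound. *)
have [|c _ fc] := compact_EVT_max _ X_compact
  (continuous_subspaceT (@rnorm_cfun_continuous f)); first by exists x.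
by exists (rnorm (f c)) => _ [y _ <-]; apply: fc; exact: mem_set.
Qed.

Lemma sup_norm1_le1 : sup_norm (1 : cfun X R[i]) <= 1.
Proof.
have rnorm1 x : rnorm ((1 : cfun X R[i]) x) = 1 by rewrite /rnorm normr1.
have [[x _]|noX] := pselect ([set: X] !=set0).
  apply: ge_sup; first by exists (rnorm ((1 : cfun X R[i]) x)), x.
  by move=> _ [y _ <-]; rewrite rnorm1.
(* On the empty space [sup] takes its default value 0. *)
rewrite /sup_norm (_ : [set: X] = set0) ?image_set0 ?sup0//.
by apply/seteqP; split=> // y _; apply: noX; exists y.
Qed.

End SupNorm.

(** The case [n = 1] gives [D >= 0]; then [2 * D / n] drops below any [e > 0] by the archimedean
    property. *)
Lemma le_of_natinv (R : realType) (s D : R[i]) : 0 <= s ->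
  (forall n, (0 < n)%N -> s <= (1 + 2 / n%:R) * D) -> s <= D.
Proof.
move=> s0 sD; have D0 : 0 <= D.
  by have := le_trans s0 (sD 1%N isT); rewrite pmulr_rge0// divr1 addr_gt0.
apply/ler_addgt0Pr => e e0; have De : 0 <= 2 * D / e.
  by rewrite divr_ge0 ?mulr_ge0// ltW.
pose n := (Num.trunc (complex.Re (2 * D / e))).+1.
have n0 : 0 < n%:R :> R[i] by rewrite ltr0n.
apply: le_trans (sD n isT) _; rewrite mulrDl mul1r lerD2l.
rewrite mulrAC ler_pdivrMr// -ler_pdivrMl// mulrC.
rewrite -[leLHS]RRe_real ?ger0_real//.
have -> : n%:R = (n%:R)%:C%C :> R[i] by rewrite rmorph_nat.
by rewrite lecR ltW// truncnS_gt.
Qed.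

Lemma multilinear_sum (F : pzRingType) (A B : lmodType F) (k : nat)
    (phi : ('I_k -> A) -> B) (a : 'I_k -> A) (i : 'I_k)
    (J : finType) (lam : J -> F) (u : J -> A) : is_multilinear phi ->
  phi (@dfwith 'I_k (fun=> A) a i (\sum_j lam j *: u j)) =
  \sum_j lam j *: phi (@dfwith 'I_k (fun=> A) a i (u j)).
Proof.
move=> /(_ a i) lin.
pose f : {linear A -> B} :=
  HB.pack (fun x => phi (@dfwith 'I_k (fun=> A) a i x))
    (GRing.isLinear.Build _ _ _ _ _ lin).
rewrite -[LHS]/(f _) linear_sum; apply: eq_bigr => j _.
by rewrite linearZ.
Qed.

Lemma inner_sum (R : realType) (H : hilbertType R) (J : finType)
    (lam : J -> R[i]) (T : J -> bop H) (x y : H) :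
  inner ((\sum_j lam j *: T j) x) y = \sum_j lam j * inner (T j x) y.
Proof.
elim/big_rec2 : _ => [|j S1 S2 _ <-]; first exact: linear0l.
transitivity (inner (lam j *: T j x + S2 x) y); first by [].
by rewrite linearDl linearZl.
Qed.

(** * Replacing the arguments by 1 one at a time *)

Section PositiveMaps.
Variables (X : topologicalType) (R : realType) (H : hilbertType R) (k : nat).
Variable phi : ('I_k -> cfun X R[i]) -> bop H.
Hypothesis phi_linear : is_multilinear phi.
Hypothesis phi_nonneg :
  forall b, (forall i, cfun_nonneg (b i)) -> bop_nonneg (phi b).

(** Induction on the list of arguments not known to be nonnegative. Expanding the one at [i] puts
    nonnegative functions [u j] there, so the induction hypothesis applies to each term; on the
    other side the entry 1 splits along the same partition. The factor [1 + 2 / n] is removed at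
    each stage, before the next expansion. *)
Lemma dominated_ones (s : seq 'I_k) (a : 'I_k -> cfun X R[i]) : uniq s ->
  (forall i, i \in s -> forall x, `|a i x : R[i]| <= 1) ->
  (forall i, i \notin s -> cfun_nonneg (a i)) ->
  dominated (phi a) (phi (fun i => if i \in s then 1 else a i)).
Proof.
elim: s a => [|i s IHs] a.
  by move=> _ _ a0; apply/nonneg_dominated/phi_nonneg => i; exact: a0.
move=> /= /andP[is_ us] a1 a0.
pose b l : cfun X R[i] := if l \in i :: s then 1 else a l.
pose at_i c u := @dfwith 'I_k (fun=> cfun X R[i]) c i u.
rewrite -/b => x y; apply: le_of_natinv; first by rewrite mulr_ge0.
move=> n n0.
have [J [lam [u [u0 sum_u sum_lam_u lam_le]]]] :=
  cfun_partition n0 (a1 i (mem_head _ _)).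
have aE : a = at_i a (\sum_j lam j *: u j).
  by apply/funext => l; rewrite /at_i; case: dfwithP.
have bE : b = at_i b (\sum_j 1 *: u j).
  apply/funext => l; rewrite /at_i; case: dfwithP => //.
  by rewrite /b mem_head -sum_u; apply: eq_bigr => j _; rewrite scale1r.
have dom j : dominated (phi (at_i a (u j))) (phi (at_i b (u j))).
  have -> : at_i b (u j) = fun l => if l \in s then 1 else at_i a (u j) l.
    apply/funext => l; rewrite /at_i; case: dfwithP => [|l' il'].
      by rewrite (negPf is_) dfwithin.
    by rewrite dfwithout// /b inE eq_sym (negPf il').
  apply: IHs => // l ls => [x'|].
    rewrite /at_i dfwithout; first by rewrite a1// inE ls orbT.
    by apply: contraNneq is_ => ->.
  move: ls; rewrite /at_i; case: dfwithP => [_|l' il' ls]; first exact: u0.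
  by apply: a0; rewrite inE negb_or eq_sym il'.
have -> : phi a = \sum_j lam j *: phi (at_i a (u j)).
  by rewrite {1}aE; exact: multilinear_sum.
have -> : phi b = \sum_j 1 *: phi (at_i b (u j)).
  by rewrite {1}bE; exact: multilinear_sum.
rewrite !inner_sum -big_split mulr_sumr/=.
apply: le_trans (ler_wpM2l _ (ler_norm_sum _ _ _)) _ => //.
rewrite mulr_sumr; apply: ler_sum => j _.
rewrite !mul1r normrM mulrCA.
have domj := dom j x y.
have domj0 := le_trans (mulr_ge0 (ler0n _ 2) (normr_ge0 _)) domj.
have [uj0|lam_j] := lam_le j; last by apply: ler_pM => //; rewrite mulr_ge0.
(* Here [lam j] has no bound, but the term vanishes: an empty sum in the argument at [i] gives 0. *)
have -> : phi (at_i a (u j)) = 0.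
  have := multilinear_sum a i (fun=> 0 : R[i]) (fun _ : 'I_0 => 0) phi_linear.
  by rewrite !big_ord0 uj0.
by rewrite [inner _ _]linear0l normr0 !mulr0 mulr_ge0// addr_ge0// divr_ge0.
Qed.

End PositiveMaps.

Theorem theorem2p1 (R : realType) (X : topologicalType)
  (X_compact : compact [set: X]) (X_hausdorff : hausdorff_space X)
  (H : hilbertType R) (k : nat) (k_ge1 : (1 <= k)%N)
  (phi : ('I_k -> cfun X R[i]) -> bop H)
  (phi_linear : is_multilinear phi)
  (phi_invariant : is_invariant phi)
  (phi_positive : is_positive phi) :
  multilinear_norm phi = (op_norm (phi (fun=> 1)))%:E.
Proof.
apply/eqP; rewrite eq_le; apply/andP; split; last first.
  by apply: ereal_sup_ubound; exists (fun=> 1) => // i; exact: sup_norm1_le1.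
apply: ge_ereal_sup => _ [a a1 <-]; rewrite lee_fin.
apply: ge_sup.
  by exists (rnorm (phi a 0)), 0 => //; rewrite /= rnorm_le normr0 ler01.
move=> _ [x x1 <-]; apply: dominated_norm x1.
(* With all indices listed, every entry becomes 1 and the nonnegativity condition is vacuous. *)
have -> : (fun=> 1) = (fun i => if i \in enum 'I_k then 1 else a i).
  by apply/funext => i; rewrite mem_enum.
apply: dominated_ones => //; first exact: positive_nonneg_tuple.
- exact: enum_uniq.
- move=> i _ y.
  have : rnorm (a i y) <= 1 := le_trans (le_sup_norm X_compact (a i) y) (a1 i).
  by rewrite rnorm_le.
- by move=> i; rewrite mem_enum.
Qed.
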